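(* Let $(X,q)$ be an asymmetric normed space and let $Y$ and $Z$ be linear subspaces of $X$ such that $X=Y\oplus Z$ (algebraic direct sum). Let $P_Y:X\to Y$ be the linear projection of $X$ onto $Y$ along $Z$, and let $I:X\to X$ be the identity. Define $\phi:Y\times Z\to X$ by $\phi(y,z)=y+z$ and $\psi:X/Y\to Z$ by $\psi(x+Y)=(I-P_Y)(x)$. Then the following statements are equivalent: (1) $P_Y$ and $I-P_Y$ are continuous (with respect to the topology induced by $q$). (2) $\phi$ is a homeomorphism. In this case, $\psi:X/Y\to Z$ is a homeomorphism as well.
   Context: An asymmetric norm on a real vector space $X$ is a function $q:X\to[0,\infty)$ such that $q(ax)=aq(x)$ for all $a\ge 0$, $q(x+y)\le q(x)+q(y)$, and $q(x)=q(-x)=0$ implies $x=0$. The pair $(X,q)$ is an asymmetric normed space; its topology is generated by the open balls $B_q(x,\epsilon)=\{y\in X: q(y-x)<\epsilon\}$. Linear subspaces carry the restriction of $q$. The product $Y\times Z$ carries the asymmetric norm $q^*(y,z)=\max\{q(y),q(z)\}$, which induces the product topology. The quotient $X/Y$ carries the topology induced by the asymmetric seminorm $w_Y(x+Y)=\inf\{q(x+y):y\in Y\}$ (generated by the balls $\{u: w_Y(u-v)<\epsilon\}$), which coincides with the quotient topology. *)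

(* Defs.v *)
From HB Require Import structures.
From mathcomp Require Import all_boot all_order all_algebra ring_quotient.
From mathcomp Require Import boolp classical_sets reals topology.

Set Implicit Arguments.
Unset Strict Implicit.
Unset Printing Implicit Defensive.

Import Order.TTheory GRing.Theory Num.Theory.
Local Open Scope classical_set_scope.
Local Open Scope ring_scope.
Local Open Scope quotient_scope.

Definition asymmetric_norm (R : realType) (X : lmodType R) (q : X -> R) : Prop :=
  [/\ forall x, 0 <= q x,
      forall (a : R) x, 0 <= a -> q (a *: x) = a * q x,
      forall x y, q (x + y) <= q x + q y
    & forall x, q x = 0 -> q (- x) = 0 -> x = 0].

Definition asym_ball (R : realType) (V : zmodType) (q : V -> R) (x : V) (e : R) :
  set V := [set y | q (y - x) < e].

(* A copy of V carrying the topology generated by the balls of q. It is defined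
   for any function q, so that it also applies to the seminorm of a quotient;
   the balls are a base as soon as q is subadditive and q 0 = 0. *)
Definition asym_space (R : realType) (V : zmodType) (q : V -> R) : Type := V.

Section AsymSpace.
Context (R : realType) (V : zmodType) (q : V -> R).

HB.instance Definition _ := Choice.copy (asym_space q) V.

HB.instance Definition _ := @isSubBaseTopological.Build (asym_space q)
  (set V) [set B | exists x e, 0 < e /\ B = asym_ball q x e] id.

End AsymSpace.

Definition homeomorphism (T U : topologicalType) (f : T -> U) : Prop :=
  continuous f /\
  exists g : U -> T, [/\ cancel f g, cancel g f & continuous g].

Definition lin_sub (R : realType) (X : lmodType R) (Y : submodClosed X) : Type :=
  {x : X | x \in Y}.

Section LinSub.
Context (R : realType) (X : lmodType R) (Y : submodClosed X).

HB.instance Definition _ := [isSub of lin_sub Y for @sval X (fun x => x \in Y)].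
HB.instance Definition _ := [Choice of lin_sub Y by <:].
HB.instance Definition _ := [SubChoice_isSubLmodule of lin_sub Y by <:].

(* Y again, known to be closed under subtraction: the library quotients a zmodType
   by a zmodClosed predicate, and does not see a submodClosed one as such. *)
Definition zmod_pred : {pred X} := Y.

HB.instance Definition _ := GRing.isZmodClosed.Build X zmod_pred
  (GRing.submod_closedB (submodClosedP Y)).

Definition quot_space : Type := Quotient.quot zmod_pred.

HB.instance Definition _ := GRing.Zmodule.on quot_space.
HB.instance Definition _ :=
  EqQuotient.copy quot_space (Quotient.quot zmod_pred).

Lemma quot_spaceE (x y : X) : x - y \in Y = (x == y %[mod quot_space]).
Proof. exact: (@Quotient.idealrBE X zmod_pred). Qed.

Lemma lin_sub_closedB : {in Y &, forall x y, x - y \in Y}.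
Proof. by case: (GRing.submod_closedB (submodClosedP Y)). Qed.

Definition sub_norm (q : X -> R) (y : lin_sub Y) : R := q (val y).

(* w_Y(x + Y) = inf {q(x + y) : y in Y}, computed at the chosen representative
   of the coset; see quot_seminormE. *)
Definition quot_seminorm (q : X -> R) (u : quot_space) : R :=
  inf [set q (repr u + y) | y in [set y | y \in Y]].

Lemma quot_seminormE (q : X -> R) (x : X) :
  quot_seminorm q (\pi_quot_space x) = inf [set q (x + y) | y in [set y | y \in Y]].
Proof.
rewrite /quot_seminorm; set x' := repr _.
have xx' : x' - x \in Y by rewrite quot_spaceE /x' reprK.
congr inf; apply/seteqP; split => _ [y yY <-] /=.
  by exists (x' - x + y); [rewrite /= rpredD | rewrite addrA subrKC].
exists (y - (x' - x)); first by rewrite /= lin_sub_closedB.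
by rewrite opprB addrCA subrKC addrC.
Qed.

End LinSub.

Definition prod_norm (R : realType) (V W : zmodType) (p : V -> R) (q : W -> R)
  (u : V * W) : R := Num.max (p u.1) (q u.2).

Definition direct_sum (R : realType) (X : lmodType R) (Y Z : submodClosed X) :
    Prop :=
  (forall x, exists y z, [/\ y \in Y, z \in Z & x = y + z]) /\
  (forall x, x \in Y -> x \in Z -> x = 0).

Section DirectSum.
Context (R : realType) (X : lmodType R) (Y Z : submodClosed X).

Definition sum_map (u : lin_sub Y * lin_sub Z) : X := val u.1 + val u.2.

Context (dYZ : direct_sum Y Z).

Lemma proj_along_subproof (x : X) : exists y : lin_sub Y, x - val y \in Z.
Proof.
have [y [z [yY zZ ->]]] := dYZ.1 x.
by exists (Sub y yY); rewrite SubK addrC addKr.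
Qed.

Definition proj_along (x : X) : lin_sub Y := sval (cid (proj_along_subproof x)).

Lemma proj_alongB (x : X) : x - val (proj_along x) \in Z.
Proof. exact: svalP (cid (proj_along_subproof x)). Qed.

Lemma proj_along_uniq (x : X) (y : lin_sub Y) :
  x - val y \in Z -> proj_along x = y.
Proof.
move=> xyZ; apply/val_inj/eqP; rewrite -subr_eq0; apply/eqP/dYZ.2.
  exact: lin_sub_closedB (valP _) (valP _).
have -> : val (proj_along x) - val y = x - val y - (x - val (proj_along x)).
  by rewrite opprB [RHS]addrC subrKA.
exact: lin_sub_closedB xyZ (proj_alongB x).
Qed.

Lemma proj_along_is_linear : linear proj_along.
Proof.
move=> a x y; apply: proj_along_uniq.
rewrite raddfD /= linearZ /= addrACA -scalerDr.
by rewrite rpredD ?rpredZ ?proj_alongB.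
Qed.

HB.instance Definition _ :=
  GRing.isLinear.Build R X (lin_sub Y) _ proj_along proj_along_is_linear.

Lemma proj_along_id (y : lin_sub Y) : proj_along (val y) = y.
Proof. by apply: proj_along_uniq; rewrite subrr rpred0. Qed.

Lemma proj_along_ker (z : lin_sub Z) : proj_along (val z) = 0.
Proof.
apply: proj_along_uniq; rewrite [val 0](raddf0 (val : lin_sub Y -> X)) subr0.
exact: valP.
Qed.

Definition proj_compl (x : X) : X := x - val (proj_along x).

(* psi(x + Y) = (I - P_Y)(x); see quot_mapE for the independence of x. *)
Definition quot_map (u : quot_space Y) : lin_sub Z :=
  Sub (proj_compl (repr u)) (proj_alongB (repr u)).

Lemma quot_mapE (x : X) : val (quot_map (\pi_(quot_space Y) x)) = proj_compl x.
Proof.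
rewrite SubK /proj_compl; set x' := repr _.
have xx' : x' - x \in Y by rewrite quot_spaceE /x' reprK.
pose y : lin_sub Y := Sub (x' - x) xx'.
have -> : x' = val y + x by rewrite SubK subrK.
have -> : proj_along (val y + x) = y + proj_along x.
  by rewrite -{2}[y]proj_along_id; exact: raddfD.
have -> : val (y + proj_along x) = val y + val (proj_along x) by exact: raddfD.
by rewrite opprD addrACA subrr add0r.
Qed.

End DirectSum.

(* Main.v *)
(* An additive map is continuous for the ball topologies as soon as it is at 0.
   The map (y, z) |-> y + z is always continuous, by the triangle inequality, and
   its inverse is x |-> (P_Y x, (I - P_Y) x), which is continuous exactly when
   both components are. The inverse of psi is z |-> z + Y, which is always
   continuous since w_Y (z + Y) <= q z; if w_Y (x + Y) < d, then q x' < d for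
   some x' in x + Y, and (I - P_Y) x' = (I - P_Y) x, so the continuity of
   I - P_Y passes to psi. *)
Require Import Defs.
From mathcomp Require Import all_boot all_order all_algebra ring_quotient.
From mathcomp Require Import boolp classical_sets reals topology.
From mathcomp Require Import finmap lra.

Set Implicit Arguments.
Unset Strict Implicit.
Unset Printing Implicit Defensive.

Import Order.TTheory GRing.Theory Num.Theory.
Local Open Scope classical_set_scope.
Local Open Scope ring_scope.
Local Open Scope quotient_scope.

(* Stated over a zmodType, since quot_space carries no scalar multiplication. *)
Definition asym_seminorm (R : realType) (V : zmodType) (p : V -> R) : Prop :=
  p 0 = 0 /\ forall x y, p (x + y) <= p x + p y.

Section AsymTopology.
Context (R : realType).

(** The smallest of finitely many radii serves all the sets at once; this handles the finite
    intersections that a subbase produces. *)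
Lemma asym_ball_seq (V : zmodType) (p : V -> R) (x : V) (s : seq (set V)) :
  (forall G, G \in s -> exists2 e : R, 0 < e & asym_ball p x e `<=` G) ->
  exists2 e : R, 0 < e & forall G, G \in s -> asym_ball p x e `<=` G.
Proof.
elim: s => [|G s IH] sB; first by exists 1.
have [G' sG'|d d0 ds] := IH; first by apply: sB; rewrite inE sG' orbT.
have [|e e0 eG] := sB G; first by rewrite inE eqxx.
exists (Num.min d e) => [|G']; first by rewrite lt_min d0.
rewrite inE => /predU1P[->|/ds dG'] y; rewrite /asym_ball /= lt_min => /andP[? ?].
  exact: eG.
exact: dG'.
Qed.

(** The topology is generated by balls with arbitrary centres; the triangle inequality allows them
    to be recentred at [x], so no symmetry of [p] is used. *)
Lemma nbhs_asymP (V : zmodType) (p : V -> R) (hp : asym_seminorm p)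
    (x : asym_space p) (A : set (asym_space p)) :
  nbhs x A <-> exists2 e : R, 0 < e & asym_ball p x e `<=` A.
Proof.
case: hp => p0 pD; split=> [|[e e0 eA]]; last first.
  exists (asym_ball p x e); split=> //; last by rewrite /asym_ball /= subrr p0.
  exists [set asym_ball p x e]; last by rewrite bigcup_set1.
  by move=> _ ->; apply: (@finI_from1 _ _ _ id); exists x, e.
case=> B [[D DI <-] [C CD Cx]] sBA.
have [F FD eC] := DI _ CD.
have [G GF|e e0 eF] := @asym_ball_seq V p x (F : seq _); last first.
  exists e => // y xy; apply: sBA; exists C => //=.
  by rewrite -eC => G GF; apply: eF xy.
have [z [r [r0 eG]]] := set_mem (FD _ GF).
have : G x by move: Cx; rewrite -eC; apply.
rewrite {}eG /asym_ball /= => zx.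
(* The part of the radius [r] left over beyond [p (x - z)] bounds a ball around [x] inside the ball
   around [z]. *)
exists (r - p (x - z)); first by rewrite subr_gt0.
move=> y /= xy; have := pD (y - x) (x - z); rewrite subrKA; lra.
Qed.

(** Since [f y - f x = f (y - x)], a radius that works at 0 works at every point. *)
Lemma continuous_asymP (V W : zmodType) (p : V -> R) (r : W -> R)
    (hp : asym_seminorm p) (hr : asym_seminorm r) (f : V -> W)
    (fB : forall x y, f (x - y) = f x - f y) :
  continuous (f : asym_space p -> asym_space r) <->
  forall e : R, 0 < e -> exists2 d : R, 0 < d & forall x, p x < d -> r (f x) < e.
Proof.
have f0 : f 0 = 0 by rewrite -(subrr 0) fB subrr.
split=> [fc e e0|fc x A /(nbhs_asymP hr)[e e0 eA]].
  have /fc /(nbhs_asymP hp)[d d0 dA] : nbhs (f 0 : asym_space r) (asym_ball r (f 0) e).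
    by apply/(nbhs_asymP hr); exists e.
  exists d => // x px; have := dA x; rewrite /asym_ball /= f0 !subr0; exact.
have [d d0 df] := fc e e0; apply/(nbhs_asymP hp); exists d => // y xy.
by apply: eA; rewrite /asym_ball /= -fB df.
Qed.

Lemma prod_seminorm (V W : zmodType) (p : V -> R) (r : W -> R) :
  asym_seminorm p -> asym_seminorm r -> asym_seminorm (prod_norm p r).
Proof.
move=> [p0 pD] [r0 rD]; split=> [|x y]; first by rewrite /prod_norm p0 r0 maxxx.
by rewrite /prod_norm ge_max (le_trans (pD _ _)) ?(le_trans (rD _ _)) //
  lerD // le_max lexx ?orbT.
Qed.

End AsymTopology.

Section AsymmetricNorm.
Context (R : realType) (X : lmodType R) (q : X -> R) (hq : asymmetric_norm q).

Lemma asymmetric_norm_seminorm : asym_seminorm q.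
Proof.
case: hq => _ qZ qD _; split=> //.
by rewrite -(scale0r (0 : X)) qZ // mul0r.
Qed.

Lemma sub_seminorm (Y : submodClosed X) : asym_seminorm (@sub_norm R X Y q).
Proof.
by have [q0 qD] := asymmetric_norm_seminorm; split=> [|x y]; [exact: q0|exact: qD].
Qed.

(** The infimum need not be attained, but a strict upper bound on it is always witnessed by a
    representative of the coset. Later arguments use such representatives in place of the
    infimum. *)
Lemma quot_seminorm_ltP (Y : submodClosed X) (u : quot_space Y) (e : R) :
  quot_seminorm q u < e <->
  exists2 x, \pi_(quot_space Y) x = u & q x < e.
Proof.
have [q_ge0 _ _ _] := hq; split=> [|[x <-]].
  have ne : [set q (repr u + y) | y in [set y | y \in Y]] !=set0.
    by exists (q (repr u + 0)), 0 => //=; exact: rpred0.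
  move=> /inf_lt -/(_ ne)[_ [y /= yY <-] qy]; exists (repr u + y) => //.
  by rewrite -[RHS]reprK; apply/eqP; rewrite -quot_spaceE addrC addKr.
rewrite quot_seminormE => /(le_lt_trans _); apply; apply: ge_inf.
  by exists 0 => _ [y _ <-].
by exists 0; rewrite /= ?addr0 ?rpred0.
Qed.

Lemma quot_seminorm_seminorm (Y : submodClosed X) :
  asym_seminorm (@quot_seminorm R X Y q).
Proof.
have [q0 qD] := asymmetric_norm_seminorm; have [q_ge0 _ _ _] := hq.
pose piD : {morph \pi_(quot_space Y) : x y / x + y} := raddfD _.
split=> [|u v].
  apply/eqP; rewrite eq_le; apply/andP; split.
    apply/ler_addgt0Pr => e e0; rewrite add0r ltW //; apply/quot_seminorm_ltP.
    by exists 0; rewrite ?q0 // raddf0.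
  rewrite leNgt; apply/negP => /quot_seminorm_ltP[x _].
  by rewrite ltNge q_ge0.
apply/ler_addgt0Pr => e e0.
(* Representatives within [e / 2] of each infimum add up to a representative of [u + v]. *)
have e20 : 0 < e / 2 by rewrite divr_gt0.
have /quot_seminorm_ltP[x <- xlt] : quot_seminorm q u < quot_seminorm q u + e / 2.
  by rewrite ltrDl.
have /quot_seminorm_ltP[y <- ylt] : quot_seminorm q v < quot_seminorm q v + e / 2.
  by rewrite ltrDl.
apply/ltW/quot_seminorm_ltP; exists (x + y); first exact: piD.
move: (qD x y) xlt ylt; lra.
Qed.

End AsymmetricNorm.

Section DirectSum.
Context (R : realType) (X : lmodType R) (Y Z : submodClosed X).
Context (dYZ : direct_sum Y Z).

Lemma lin_sub_valB (W : submodClosed X) (u v : lin_sub W) :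
  val (u - v) = val u - val v.
Proof. exact: raddfB. Qed.

(** The map [proj_compl] with its codomain restricted to [Z]. *)
Definition proj_other (x : X) : lin_sub Z :=
  Sub (proj_compl dYZ x) (proj_alongB dYZ x).

Definition split_map (x : X) : lin_sub Y * lin_sub Z :=
  (proj_along dYZ x, proj_other x).

Lemma sum_mapB u v : @sum_map R X Y Z (u - v) = sum_map u - sum_map v.
Proof. by rewrite /sum_map !lin_sub_valB opprD addrACA. Qed.

Lemma proj_complB x y : proj_compl dYZ (x - y) = proj_compl dYZ x - proj_compl dYZ y.
Proof. by rewrite /proj_compl raddfB lin_sub_valB opprD addrACA -opprD. Qed.

Lemma proj_otherB x y : proj_other (x - y) = proj_other x - proj_other y.
Proof. by apply: val_inj; rewrite lin_sub_valB /= proj_complB. Qed.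

Lemma split_mapB x y : split_map (x - y) = split_map x - split_map y.
Proof. by rewrite /split_map raddfB proj_otherB. Qed.

Lemma split_mapK : cancel split_map (@sum_map R X Y Z).
Proof. by move=> x; rewrite /sum_map /= /proj_compl addrC subrK. Qed.

Lemma sum_mapK : cancel (@sum_map R X Y Z) split_map.
Proof.
move=> [y z]; have e : proj_along dYZ (val y + val z) = y.
  by rewrite raddfD /= proj_along_id proj_along_ker addr0.
rewrite /split_map /sum_map /= e; congr pair; apply: val_inj => /=.
by rewrite /proj_compl e addrC addKr.
Qed.

Lemma quot_map_pi x : quot_map dYZ (\pi_(quot_space Y) x) = proj_other x.
Proof. by apply: val_inj; rewrite quot_mapE. Qed.

(** Chosen representatives need not respect subtraction, so the identity is carried over from
    [proj_other] through the projection. *)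
Lemma quot_mapB u v : quot_map dYZ (u - v) = quot_map dYZ u - quot_map dYZ v.
Proof.
rewrite -[u]reprK -[v]reprK !quot_map_pi -proj_otherB -quot_map_pi.
by congr quot_map; rewrite raddfB.
Qed.

Lemma proj_other_val (z : lin_sub Z) : proj_other (val z) = z.
Proof.
by apply: val_inj; rewrite /= /proj_compl proj_along_ker /= subr0.
Qed.

(** The two representatives differ by the [Y]-component of [x]. *)
Lemma val_proj_other x : \pi_(quot_space Y) (val (proj_other x)) = \pi_(quot_space Y) x.
Proof.
apply/eqP; rewrite -quot_spaceE /= /proj_compl addrAC subrr add0r -scaleN1r rpredZ //.
exact: valP.
Qed.

End DirectSum.

Theorem theorem4p2 (R : realType) (X : lmodType R) (q : X -> R)
    (hq : asymmetric_norm q) (Y Z : submodClosed X) (dYZ : direct_sum Y Z) :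
  let XT := asym_space q in
  let YT := asym_space (@sub_norm R X Y q) in
  let ZT := asym_space (@sub_norm R X Z q) in
  let YZT := asym_space (prod_norm (@sub_norm R X Y q) (@sub_norm R X Z q)) in
  let XYT := asym_space (@quot_seminorm R X Y q) in
  ((continuous (proj_along dYZ : XT -> YT) /\
    continuous (proj_compl dYZ : XT -> XT)) <->
   homeomorphism (@sum_map R X Y Z : YZT -> XT)) /\
  (homeomorphism (@sum_map R X Y Z : YZT -> XT) ->
   homeomorphism (quot_map dYZ : XYT -> ZT)).
Proof.
move=> XT YT ZT YZT XYT.
have hX := asymmetric_norm_seminorm hq.
have hY := sub_seminorm hq Y.
have hZ := sub_seminorm hq Z.
have hYZ := prod_seminorm hY hZ.
have hXY := quot_seminorm_seminorm hq Y.
have PB x y : proj_along dYZ (x - y) = proj_along dYZ x - proj_along dYZ y.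
  exact: raddfB.
have equiv : (continuous (proj_along dYZ : XT -> YT) /\
    continuous (proj_compl dYZ : XT -> XT)) <->
   homeomorphism (@sum_map R X Y Z : YZT -> XT).
  split=> [[/(continuous_asymP hX hY PB) cP
            /(continuous_asymP hX hX (proj_complB dYZ)) cQ]|].
    split.
      apply/(continuous_asymP hYZ hX (@sum_mapB _ _ _ _)) => e e0.
      exists (e / 2) => [|[y z]]; first by rewrite divr_gt0.
      rewrite /prod_norm gt_max /sub_norm /sum_map /= => /andP[].
      by have := hX.2 (val y) (val z); lra.
    exists (split_map dYZ); split; [exact: sum_mapK|exact: split_mapK|].
    apply/(continuous_asymP hX hYZ (split_mapB dYZ)) => e e0.
    have [d d0 dP] := cP e e0; have [d' d'0 dQ] := cQ e e0.
    exists (Num.min d d') => [|x]; first by rewrite lt_min d0.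
    by rewrite lt_min gt_max => /andP[/dP Px /dQ Qx]; apply/andP; split.
  case=> _ [g [_ gK cg]].
  (* Inverses are unique, so the continuous inverse is the explicit one. *)
  have {gK} eg : g = split_map dYZ by apply/funext => x; rewrite -{2}(gK x) sum_mapK.
  move: cg; rewrite {}eg => /(continuous_asymP hX hYZ (split_mapB dYZ)) cg.
  (* A bound on the maximum bounds both components, and [Z] carries the restriction of [q], so the
     second bound is the one for [proj_compl]. *)
  split; [apply/(continuous_asymP hX hY PB) |
          apply/(continuous_asymP hX hX (proj_complB dYZ))] => e /cg[d d0 dg];
    by exists d => // x /dg; rewrite gt_max => /andP[].
split=> // /equiv[_ /(continuous_asymP hX hX (proj_complB dYZ)) cQ]; split.
  apply/(continuous_asymP hXY hZ (quot_mapB dYZ)) => e /cQ[d d0 dQ].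
  exists d => // u /(quot_seminorm_ltP hq)[x <- /dQ].
  by rewrite quot_map_pi.
exists (fun z => \pi_(quot_space Y) (val z)); split.
- by move=> u; rewrite -[u in LHS]reprK quot_map_pi val_proj_other reprK.
- by move=> z; rewrite quot_map_pi proj_other_val.
apply/(continuous_asymP hZ hXY) => [x y|e e0]; first by rewrite lin_sub_valB raddfB.
(* The same radius works, because [z] represents its own coset. *)
exists e => // z ze; apply/(quot_seminorm_ltP hq).
by exists (val z).
Qed.
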